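(* Let $\Omega\subset\mathbb{R}^n$ be open and let $\Phi:\Omega\times\mathbb{R}^m\to[0,\infty]$ be a strong $\Phi$-function. Then the following two conditions are equivalent: (A1): for every $K>0$ there exists $\beta>0$ such that for all balls $B\subset\mathbb{R}^n$ with $\mu(B)\le 1$ and all $\xi\in\mathbb{R}^m$, \[ \Phi_B^+(\beta\xi)\le \Phi_B^-(\xi)+1\qquad\text{whenever } \Phi_B^-(\xi)\le \tfrac{K}{\mu(B)}; \] (M): for every $K>0$ there exists $\beta>0$ such that for all balls $B\subset\mathbb{R}^n$ with $\mu(B)\le 1$ and all $\xi\in\mathbb{R}^m$, \[ \Phi_B^+(\beta\xi)\le (\Phi_B^-)^{\mathrm{conv}}(\xi)+1\qquad\text{whenever } (\Phi_B^-)^{\mathrm{conv}}(\xi)\le \tfrac{K}{\mu(B)}. \]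
   Context: Here $\mu$ is a fixed Borel measure on $\mathbb{R}^n$; ''a.e.'', $\operatorname{ess\,inf}$ and $\operatorname{ess\,sup}$ are with respect to $\mu$. Only balls $B$ with $\mu(B\cap\Omega)>0$ are considered. A function $\Phi:\Omega\times\mathbb{R}^m\to[0,\infty]$ is a strong $\Phi$-function if: (1) $x\mapsto\Phi(x,\xi)$ is measurable for every $\xi\in\mathbb{R}^m$; (2) $\Phi(x,0)=\lim_{\xi\to0}\Phi(x,\xi)=0$ and $\lim_{\xi\to\infty}\Phi(x,\xi)=\infty$ (i.e. as $|\xi|\to\infty$) for a.e. $x\in\Omega$; (3) $\xi\mapsto\Phi(x,\xi)$ is continuous in the topology of $[0,\infty]$ for a.e. $x\in\Omega$; (4) $\xi\mapsto\Phi(x,\xi)$ is convex for a.e. $x\in\Omega$. For a ball $B$, $\Phi_B^-(\xi):=\operatorname{ess\,inf}_{x\in B\cap\Omega}\Phi(x,\xi)$ and $\Phi_B^+(\xi):=\operatorname{ess\,sup}_{x\in B\cap\Omega}\Phi(x,\xi)$. For a function $F:\mathbb{R}^m\to[0,\infty]$, $F^{\mathrm{conv}}$ denotes its greatest convex minorant, i.e. the pointwise largest convex function $\mathbb{R}^m\to[0,\infty]$ that is $\le F$. *)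

(* Defs.v *)
From HB Require Import structures.
From mathcomp Require Import all_boot all_order all_algebra.
From mathcomp Require Import all_classical all_reals all_analysis.
From mathcomp Require Import measurable_realfun ess_sup_inf.
Set Implicit Arguments.
Unset Strict Implicit.
Unset Printing Implicit Defensive.
Import Order.TTheory GRing.Theory Num.Theory.
Import numFieldNormedType.Exports.
Local Open Scope classical_set_scope.
Local Open Scope ring_scope.
Local Open Scope ereal_scope.

(* R^n with its Borel sigma-algebra *)
Notation borel_rV R n := (g_sigma_algebraType (@open 'rV[R]_n)).

(* The library norm on 'rV[R]_n is the sup norm, whose balls are cubes. *)
Definition enorm (R : realType) (n : nat) (x : 'rV[R]_n) : R :=
  Num.sqrt (\sum_(i < n) x ord0 i ^+ 2)%R.

Definition eball (R : realType) (n : nat) (c : 'rV[R]_n) (r : R) :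
    set 'rV[R]_n :=
  [set x | (enorm (x - c) < r)%R].

(* The filter of the limit "xi tends to infinity", i.e. |xi| -> oo *)
Definition enorm_infty (R : realType) (m : nat) : set_system 'rV[R]_m :=
  [set A | \forall r \near +oo%R, forall xi, (r <= enorm xi)%R -> A xi].

(* Only used for functions with values in [0, +oo], so that the right-hand
   side is never of the form oo - oo; in \bar R, 0 * +oo = 0. *)
Definition convex_ereal (R : realType) (m : nat) (F : 'rV[R]_m -> \bar R) :=
  forall (x y : 'rV[R]_m) (t : R), (0 <= t <= 1)%R ->
    F (t *: x + (1 - t) *: y)%R <= t%:E * F x + (1 - t)%:E * F y.

Definition convex_minorants (R : realType) (m : nat) (F : 'rV[R]_m -> \bar R) :
    set ('rV[R]_m -> \bar R) :=
  [set G | [/\ forall xi, 0 <= G xi, convex_ereal G & forall xi, G xi <= F xi]].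

Definition convex_envelope (R : realType) (m : nat) (F : 'rV[R]_m -> \bar R)
    (xi : 'rV[R]_m) : \bar R :=
  ereal_sup [set G xi | G in convex_minorants F].

(* The pointwise supremum is itself a convex minorant, hence the greatest one. *)
Lemma convex_envelope_greatest (R : realType) (m : nat)
    (F : 'rV[R]_m -> \bar R) : (forall xi, 0 <= F xi) ->
  convex_minorants F (convex_envelope F) /\
  (forall G, convex_minorants F G -> forall xi, G xi <= convex_envelope F xi).
Proof.
move=> F0.
have ub G : convex_minorants F G -> forall xi, G xi <= convex_envelope F xi.
  by move=> FG xi; apply: ereal_sup_ubound; exists G.
split=> //; split.
- move=> xi; apply: (ub (cst 0)); split=> //= x y t _.
  by rewrite /cst !mule0 adde0.
- move=> x y t /andP[t0 t1]; apply: ge_ereal_sup => _ [G FG <-].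
  have [_ cG _] := FG; apply: (le_trans (cG x y t _)); first by rewrite t0.
  by apply: leeD; apply: lee_wpmul2l; rewrite ?lee_fin ?subr_ge0 //; exact: ub.
- by move=> xi; apply: ge_ereal_sup => _ [G [_ _ GF] <-].
Qed.

(* Functions on Omega x R^m are total functions whose values at x outside
   Omega are unconstrained and never used. *)
Record strong_Phi_function (R : realType) (n m : nat)
    (mu : {measure set (borel_rV R n) -> \bar R}) (Omega : set 'rV[R]_n)
    (Phi : 'rV[R]_n -> 'rV[R]_m -> \bar R) : Prop := StrongPhiFunction {
  Phi_ge0 : forall x, Omega x -> forall xi, 0 <= Phi x xi ;
  Phi_measurable : forall xi,
    measurable_fun (Omega : set (borel_rV R n))
      (Phi ^~ xi : borel_rV R n -> \bar R) ;
  Phi_limits : {ae mu, forall x, Omega x ->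
    [/\ Phi x 0%R = 0,
        Phi x xi @[xi --> (0%R : 'rV[R]_m)^'] --> 0 &
        Phi x xi @[xi --> @enorm_infty R m] --> +oo]} ;
  Phi_continuous : {ae mu, forall x, Omega x -> continuous (Phi x)} ;
  Phi_convex : {ae mu, forall x, Omega x -> convex_ereal (Phi x)} }.

(* Essential bounds of f over D: extending f by the neutral value of inf
   (resp. sup) outside D leaves the essential bound over D unchanged. *)
Definition ess_inf_on (R : realType) (n : nat)
    (mu : {measure set (borel_rV R n) -> \bar R}) (D : set 'rV[R]_n)
    (f : 'rV[R]_n -> \bar R) : \bar R :=
  ess_inf mu (patch (cst +oo) D f).

Definition ess_sup_on (R : realType) (n : nat)
    (mu : {measure set (borel_rV R n) -> \bar R}) (D : set 'rV[R]_n)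
    (f : 'rV[R]_n -> \bar R) : \bar R :=
  ess_sup mu (patch (cst -oo) D f).

Definition Phi_inf (R : realType) (n m : nat)
    (mu : {measure set (borel_rV R n) -> \bar R}) (Omega : set 'rV[R]_n)
    (Phi : 'rV[R]_n -> 'rV[R]_m -> \bar R) (B : set 'rV[R]_n)
    (xi : 'rV[R]_m) : \bar R :=
  ess_inf_on mu (B `&` Omega) (Phi ^~ xi).

Definition Phi_sup (R : realType) (n m : nat)
    (mu : {measure set (borel_rV R n) -> \bar R}) (Omega : set 'rV[R]_n)
    (Phi : 'rV[R]_n -> 'rV[R]_m -> \bar R) (B : set 'rV[R]_n)
    (xi : 'rV[R]_m) : \bar R :=
  ess_sup_on mu (B `&` Omega) (Phi ^~ xi).

Definition condition_A1 (R : realType) (n m : nat)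
    (mu : {measure set (borel_rV R n) -> \bar R}) (Omega : set 'rV[R]_n)
    (Phi : 'rV[R]_n -> 'rV[R]_m -> \bar R) : Prop :=
  forall K : R, (0 < K)%R -> exists2 beta : R, (0 < beta)%R &
    forall (c : 'rV[R]_n) (r : R), (0 < r)%R ->
    let B := eball c r in
    0 < mu (B `&` Omega) -> mu B <= 1 ->
    forall xi : 'rV[R]_m,
      Phi_inf mu Omega Phi B xi <= K%:E / mu B ->
      Phi_sup mu Omega Phi B (beta *: xi)%R <= Phi_inf mu Omega Phi B xi + 1.

Definition condition_M (R : realType) (n m : nat)
    (mu : {measure set (borel_rV R n) -> \bar R}) (Omega : set 'rV[R]_n)
    (Phi : 'rV[R]_n -> 'rV[R]_m -> \bar R) : Prop :=
  forall K : R, (0 < K)%R -> exists2 beta : R, (0 < beta)%R &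
    forall (c : 'rV[R]_n) (r : R), (0 < r)%R ->
    let B := eball c r in
    0 < mu (B `&` Omega) -> mu B <= 1 ->
    forall xi : 'rV[R]_m,
      convex_envelope (Phi_inf mu Omega Phi B) xi <= K%:E / mu B ->
      Phi_sup mu Omega Phi B (beta *: xi)%R <=
        convex_envelope (Phi_inf mu Omega Phi B) xi + 1.

(* Main.v *)
Require Import Defs.
From HB Require Import structures.
From mathcomp Require Import all_boot all_order all_algebra.
From mathcomp Require Import all_classical all_reals all_analysis.
From mathcomp Require Import measurable_realfun ess_sup_inf.
From mathcomp Require Import ring lra.
Set Implicit Arguments.
Unset Strict Implicit.
Unset Printing Implicit Defensive.
Import Order.TTheory GRing.Theory Num.Theory.
Import numFieldNormedType.Exports.
Local Open Scope classical_set_scope.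
Local Open Scope ring_scope.

(** Write [F] for the essential infimum of [Phi] over a ball [B], [G] for its
greatest convex minorant and [S] for the essential supremum. As [G <= F], (M)
immediately implies (A1) with the same [beta].

For the converse, apply (A1) with [2 K] and put [Psi xi := S (beta xi)]. Then
[Psi] is convex, [Psi 0 <= 0], and for a finite level [L <= 2 K / mu B] with
[G xi < L] one knows [Psi <= F + 1] only on the set [{F <= L}]. The function
[F] need not be convex, but it is star-shaped: [F (s x) <= s F x] for
[0 < s <= 1]. This is enough to control it above the level [L] by linear
growth: if [L < F x < oo], then [zeta := (L / F x) x] satisfies [F zeta <= L],
hence [Psi zeta <= L + 1], while [F x = L s] for [x = s zeta].
Consequently
[[ H x := inf { p + L s | x = eta + s zeta, Psi eta <= p + 1, Psi zeta <= L + 1 } ]]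
(with [p], [s >= 0]), the infimal convolution of [max (Psi - 1) 0] with [L]
times the gauge of the convex set [{Psi <= L + 1}], is at most [F]: take
[s = 0] below the level [L], and [p = 0], [eta = 0] above it. As [H] is convex,
[H <= G]. Conversely, if [p + L s < L] then [s < 1], so
[Psi (s zeta) <= s (L + 1)], and by convexity
[[ Psi (x / 2) <= (p + 1 + s L + s) / 2 <= p + L s + 1. ]]
Taking the infimum, [Psi (x / 2) <= G x + 1] whenever [G x < L], which is (M)
with [beta / 2]. The argument, in [half_le_convex_envelope], avoids finite convex
combinations, so the constant does not depend on the dimension [m]. *)

(** * Convex functions with values in the extended reals *)

Lemma convex_ereal_scale (R : realType) (m : nat) (F : 'rV[R]_m -> \bar R)
    (s : R) (x : 'rV[R]_m) :
  convex_ereal F -> (F 0%R <= 0)%E -> 0 <= s <= 1 ->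
  (F (s *: x)%R <= s%:E * F x)%E.
Proof.
move=> cF F0 s01; have := cF x 0 s s01; rewrite scaler0 addr0 => /le_trans; apply.
rewrite geeDl //; apply: mule_ge0_le0 => //.
by case/andP: s01 => _; rewrite lee_fin subr_ge0.
Qed.

Lemma convex_ereal_comb_le (R : realType) (m : nat) (F : 'rV[R]_m -> \bar R)
    (x y : 'rV[R]_m) (t a b : R) :
  convex_ereal F -> 0 <= t <= 1 -> (F x <= a%:E)%E -> (F y <= b%:E)%E ->
  (F (t *: x + (1 - t) *: y)%R <= (t * a + (1 - t) * b)%:E)%E.
Proof.
move=> cF /andP[t0 t1] Fx Fy; apply: (le_trans (cF x y t _)); first exact/andP.
rewrite [leRHS]EFinD !EFinM.
by apply: leeD; apply: lee_wpmul2l; rewrite ?lee_fin ?subr_ge0.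
Qed.

(** [E] plays the role of an epigraph: a set of pairs [(x, v)] that is convex has
a convex lower boundary. Only the open range [0 < t < 1] is asked of [E],
because at [t = 0] the term [0 * H x] vanishes even if no [v] lies above [x]. *)
Lemma convex_ereal_inf_epigraph (R : realType) (m : nat)
    (E : 'rV[R]_m -> set R) :
  (forall x v, E x v -> 0 <= v) ->
  (forall x y v w t, 0 < t < 1 -> E x v -> E y w ->
     E (t *: x + (1 - t) *: y) (t * v + (1 - t) * w)) ->
  convex_ereal (fun x => ereal_inf [set v%:E | v in E x]).
Proof.
move=> E0 cE x y t; pose H z := ereal_inf [set v%:E | v in E z].
rewrite -/(H _) -/(H x) -/(H y).
have H0 z : (0 <= H z)%E.
  by apply: le_ereal_inf_tmp => _ [v Ev <-]; rewrite lee_fin (E0 _ _ Ev).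
case/andP; rewrite le_eqVlt => /predU1P[<- _|t0].
  by rewrite scale0r add0r subr0 scale1r mul0e mul1e add0e.
rewrite le_eqVlt => /predU1P[->|t1].
  by rewrite subrr scale0r addr0 scale1r mul0e mul1e adde0.
have t1' : 0 < 1 - t by rewrite subr_gt0.
have [->|Hx] := eqVneq (H x) +oo%E.
  rewrite gt0_muley ?lte_fin // addye ?leey // gt_eqF //.
  by rewrite (lt_le_trans ltNy0) // mule_ge0 // lee_fin ltW.
have [->|Hy] := eqVneq (H y) +oo%E.
  rewrite [X in (_ + X)%E]gt0_muley ?lte_fin // addey ?leey // gt_eqF //.
  by rewrite (lt_le_trans ltNy0) // mule_ge0 // lee_fin ltW.
have fx : H x \is a fin_num by rewrite ge0_fin_numE // ltey.
have fy : H y \is a fin_num by rewrite ge0_fin_numE // ltey.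
apply/lee_addgt0Pr => e e0.
have [_ [v Ev <-] ltv] := lb_ereal_inf_adherent e0 fx.
have [_ [w Ew <-] ltw] := lb_ereal_inf_adherent e0 fy.
move: ltv ltw; rewrite -/(H x) -/(H y) -(fineK fx) -(fineK fy).
rewrite -!EFinM -!EFinD !lte_fin => ltv ltw.
apply: (@le_trans _ _ (t * v + (1 - t) * w)%:E).
  apply: ereal_inf_lbound; exists (t * v + (1 - t) * w) => //.
  by apply: cE => //; rewrite t0.
rewrite lee_fin; nra.
Qed.

Lemma convex_envelope_le (R : realType) (m : nat) (F : 'rV[R]_m -> \bar R) xi :
  (convex_envelope F xi <= F xi)%E.
Proof. by apply: ge_ereal_sup => _ [G [_ _ GF] <-]. Qed.

Lemma convex_envelope_ge0 (R : realType) (m : nat) (F : 'rV[R]_m -> \bar R) xi :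
  (forall x, 0 <= F x)%E -> (0 <= convex_envelope F xi)%E.
Proof. by move=> F0; have [[+ _ _] _] := convex_envelope_greatest F0. Qed.

(** * A convex minorant by infimal convolution *)

(** The values whose infimum at [x] is the infimal convolution of
[max (Psi - 1) 0] and [L] times the gauge of [{Psi <= L + 1}]. Bounding [Psi]
by a real [p + 1] replaces the subtraction of [1] from an extended real. *)
Definition split_cost (R : realType) (m : nat) (Psi : 'rV[R]_m -> \bar R)
    (L : R) (x : 'rV[R]_m) : set R :=
  [set v | exists p s eta zeta,
    [/\ 0 <= p, 0 <= s, (Psi eta <= (p + 1)%:E)%E, (Psi zeta <= (L + 1)%:E)%E
      & x = eta + s *: zeta /\ v = p + L * s]].

(** The gauge part is the point to check: for the convex set
[C := {Psi <= L + 1}] and [a, b >= 0], one has [a C + b C] included in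
[(a + b) C], by normalising the weights. *)
Lemma split_cost_convex (R : realType) (m : nat) (Psi : 'rV[R]_m -> \bar R)
    (L : R) (x y : 'rV[R]_m) (v w t : R) :
  convex_ereal Psi -> 0 < t < 1 ->
  split_cost Psi L x v -> split_cost Psi L y w ->
  split_cost Psi L (t *: x + (1 - t) *: y) (t * v + (1 - t) * w).
Proof.
move=> cPsi /andP[t0 t1] [p1 [s1 [eta1 [zeta1 [p10 s10 Pe1 Pz1 [-> ->]]]]]].
move=> [p2 [s2 [eta2 [zeta2 [p20 s20 Pe2 Pz2 [-> ->]]]]]].
have t01 : 0 <= t <= 1 by rewrite !ltW.
have u0 : 0 < 1 - t by rewrite subr_gt0.
have ts1 : 0 <= t * s1 by rewrite mulr_ge0 // ltW.
have us2 : 0 <= (1 - t) * s2 by rewrite mulr_ge0 // ltW.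
set s := t * s1 + (1 - t) * s2.
have [zeta Pz zetaE] : exists2 zeta, (Psi zeta <= (L + 1)%:E)%E &
    s *: zeta = (t * s1) *: zeta1 + ((1 - t) * s2) *: zeta2.
  (* If s = 0 both gauge terms vanish and any point of the sublevel set will do. *)
  have [s0|s0] := eqVneq s 0.
    have /andP[/eqP e1 /eqP e2] : (t * s1 == 0) && ((1 - t) * s2 == 0).
      by rewrite -paddr_eq0 // -/s s0.
    by exists zeta1 => //; rewrite s0 e1 e2 !scale0r addr0.
  have sgt0 : 0 < s by rewrite lt_neqAle eq_sym s0 addr_ge0.
  pose a := t * s1 / s.
  have a1 : 1 - a = (1 - t) * s2 / s by rewrite /a /s; field.
  exists (a *: zeta1 + (1 - a) *: zeta2).
    rewrite (_ : L + 1 = a * (L + 1) + (1 - a) * (L + 1)); last by ring.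
    apply: convex_ereal_comb_le => //.
    apply/andP; split; first by rewrite divr_ge0 // ltW.
    by rewrite -subr_ge0 a1 divr_ge0 // ltW.
  by rewrite a1 scalerDr !scalerA ![s * _]mulrC !divfK.
exists (t * p1 + (1 - t) * p2), s, (t *: eta1 + (1 - t) *: eta2), zeta; split.
- by rewrite addr_ge0 // mulr_ge0 // ltW.
- by rewrite addr_ge0.
- rewrite (_ : _ + 1 = t * (p1 + 1) + (1 - t) * (p2 + 1)); last by ring.
  exact: convex_ereal_comb_le.
- by [].
- split; last by rewrite /s; ring.
  by rewrite zetaE !scalerDr !scalerA addrACA.
Qed.

(** A convex [Psi] that is dominated by the star-shaped [F] up to [1], but only
below the level [L], is still dominated by the convex envelope of [F] there,
at the price of halving the argument. The infimum of [split_cost] is a convex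
minorant of [F], and the factor [1/2] comes from averaging the two parts of an
almost optimal splitting. *)
Lemma half_le_convex_envelope (R : realType) (m : nat)
    (Psi F : 'rV[R]_m -> \bar R) (L : R) :
  0 < L -> (forall x, 0 <= F x)%E ->
  (forall (s : R) x, 0 < s <= 1 -> (F (s *: x)%R <= s%:E * F x)%E) ->
  convex_ereal Psi -> (Psi 0%R <= 0)%E ->
  (forall x, F x <= L%:E -> Psi x <= F x + 1)%E ->
  forall x, (convex_envelope F x < L%:E)%E ->
    (Psi (2^-1 *: x)%R <= convex_envelope F x + 1)%E.
Proof.
move=> L0 F0 starF cPsi Psi0 PsiF x envx.
pose H z := ereal_inf [set v%:E | v in split_cost Psi L z].
have cost_ge0 z v : split_cost Psi L z v -> 0 <= v.
  by move=> [p [s [_ [_ [p0 s0 _ _ [_ ->]]]]]]; rewrite addr_ge0 // mulr_ge0 // ltW.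
have Hmin : convex_minorants F H.
  split.
  - move=> z; apply: le_ereal_inf_tmp => _ [v Ev <-].
    by rewrite lee_fin (cost_ge0 _ _ Ev).
  - by apply: convex_ereal_inf_epigraph => // *; exact: split_cost_convex.
  - move=> z.
    have PsiL y : (F y <= L%:E -> Psi y <= (L + 1)%:E)%E.
      move=> FL; apply: (le_trans (PsiF _ FL)).
      by rewrite EFinD leeD2r.
    have [->|Fz] := eqVneq (F z) +oo%E; first exact: leey.
    have fF : F z \is a fin_num by rewrite ge0_fin_numE // ltey.
    have Fz0 : 0 <= fine (F z) by rewrite fine_ge0.
    rewrite -(fineK fF); apply: ereal_inf_lbound; exists (fine (F z)) => //.
    have [FL|FL] := leP (fine (F z)) L.
      exists (fine (F z)), 0, z, 0; split=> //.
      - by rewrite EFinD fineK // PsiF // -(fineK fF) lee_fin.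
      - by apply: (le_trans Psi0); rewrite lee_fin addr_ge0 // ltW.
      - by rewrite scaler0 addr0 mulr0 addr0.
    (* Above the level L, star-shapedness pulls z back to a point where F <= L. *)
    have Fgt0 : 0 < fine (F z) by rewrite (lt_trans L0).
    pose s := fine (F z) / L.
    have s0 : s != 0 by rewrite mulf_neq0 ?invr_eq0 ?gt_eqF.
    exists 0, s, 0, (s^-1 *: z); split=> //.
    - by rewrite divr_ge0 // ltW.
    - by apply: (le_trans Psi0); rewrite lee_fin add0r.
    - apply: PsiL; apply: le_trans (starF _ _ _) _.
        by rewrite invf_div divr_gt0 //= ler_pdivrMr // mul1r ltW.
      rewrite -(fineK fF) -EFinM lee_fin /s invf_div mulfVK ?gt_eqF //.
    - by rewrite add0r add0r scalerA divff // scale1r /s mulrC divfK ?gt_eqF.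
have Hx : (H x <= convex_envelope F x)%E.
  by have [_] := convex_envelope_greatest F0; apply.
have env0 : (0 <= convex_envelope F x)%E by exact: convex_envelope_ge0.
have fenv : convex_envelope F x \is a fin_num.
  by rewrite ge0_fin_numE // (lt_trans envx) ?ltey.
move: envx Hx env0; rewrite -(fineK fenv); set g := fine _.
rewrite lte_fin lee_fin => gL Hx g0.
apply/lee_addgt0Pr => e e0.
(* The tolerance is at most L - g, so that the splitting costs less than L and
   the gauge coefficient s stays below 1. *)
have : (H x < (g + Num.min e (L - g))%:E)%E.
  by apply: le_lt_trans Hx _; rewrite lte_fin ltrDl lt_min e0 subr_gt0.
move/ereal_inf_lt => [_ [_ [p [s [eta [zeta [p0 s0 Pe Pz [-> ->]]]]]]] <-].
rewrite lte_fin => lt_pLs.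
have lte : p + L * s < g + e.
  by apply: lt_le_trans lt_pLs _; rewrite lerD2l ge_min lexx.
have ltL : p + L * s < L.
  by apply: lt_le_trans lt_pLs _; rewrite -lerBrDl ge_min lexx orbT.
have s1 : s <= 1 by nra.
have Psz : (Psi (s *: zeta) <= (s * (L + 1))%:E)%E.
  have s01 : 0 <= s <= 1 by rewrite s0.
  apply: le_trans (convex_ereal_scale zeta cPsi Psi0 s01) _.
  by rewrite EFinM lee_wpmul2l // lee_fin.
have half : 1 - 2^-1 = 2^-1 :> R by field.
have h01 : 0 <= (2^-1 : R) <= 1 by apply/andP; split; lra.
have := convex_ereal_comb_le cPsi h01 Pe Psz.
rewrite half -scalerDr => /le_trans; apply.
rewrite -!EFinD lee_fin; nra.
Qed.

(** * Essential bounds over a ball *)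

(** The measure lives on a copy of the space carrying the Borel sigma-algebra;
this lets the a.e. filter be found for predicates on the space itself. *)
#[local] Instance ae_borel_filter (R : realType) (n : nat)
    (mu : {measure set (borel_rV R n) -> \bar R}) :
  @Filter 'rV[R]_n (almost_everywhere mu) := ae_filter_ringOfSetsType mu.

Lemma ess_sup_on_leP (R : realType) (n : nat)
    (mu : {measure set (borel_rV R n) -> \bar R}) (D : set 'rV[R]_n)
    (f : 'rV[R]_n -> \bar R) (y : \bar R) :
  (ess_sup_on mu D f <= y)%E <-> {ae mu, forall x, D x -> (f x <= y)%E}.
Proof.
split.
- move/ess_supP; apply: filterS => x + Dx.
  by rewrite /patch mem_set.
- move=> fy; apply/ess_supP; move: fy; apply: filterS => x fy.
  by rewrite /patch; case: ifPn => [/set_mem/fy//|_]; exact: leNye.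
Qed.

Lemma le_ess_inf_onP (R : realType) (n : nat)
    (mu : {measure set (borel_rV R n) -> \bar R}) (D : set 'rV[R]_n)
    (f : 'rV[R]_n -> \bar R) (y : \bar R) :
  (y <= ess_inf_on mu D f)%E <-> {ae mu, forall x, D x -> (y <= f x)%E}.
Proof.
split.
- move/ess_infP; apply: filterS => x + Dx.
  by rewrite /patch mem_set.
- move=> fy; apply/ess_infP; move: fy; apply: filterS => x fy.
  by rewrite /patch; case: ifPn => [/set_mem/fy//|_]; exact: leey.
Qed.

Section PhiBounds.
Context (R : realType) (n m : nat).
Context (mu : {measure set (borel_rV R n) -> \bar R}) (Omega : set 'rV[R]_n).
Context (Phi : 'rV[R]_n -> 'rV[R]_m -> \bar R).
Context (hPhi : strong_Phi_function mu Omega Phi).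
Implicit Types (B : set 'rV[R]_n) (xi : 'rV[R]_m).

Lemma Phi_inf_ge0 B xi : (0 <= Phi_inf mu Omega Phi B xi)%E.
Proof.
by apply/le_ess_inf_onP; apply: nearW => x [_ Ox]; exact: (Phi_ge0 hPhi).
Qed.

Lemma Phi_sup0_le0 B : (Phi_sup mu Omega Phi B 0%R <= 0)%E.
Proof.
apply/ess_sup_on_leP; have := Phi_limits hPhi.
by apply: filterS => x + [_ Ox] => /(_ Ox)[->].
Qed.

Lemma Phi_sup_convex B : convex_ereal (Phi_sup mu Omega Phi B).
Proof.
move=> x y t t01; apply/ess_sup_on_leP.
have /ess_sup_on_leP := lexx (Phi_sup mu Omega Phi B x).
have /ess_sup_on_leP := lexx (Phi_sup mu Omega Phi B y).
have := Phi_convex hPhi.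
apply: filterS3 => z cz ly lx [Bz Oz].
apply: (le_trans (cz Oz x y t t01)); case/andP: t01 => t0 t1.
apply: leeD; apply: lee_wpmul2l; rewrite ?lee_fin ?subr_ge0 //.
- exact: lx.
- exact: ly.
Qed.

(** An infimum of convex functions is not convex, but it stays star-shaped with
respect to [0]. *)
Lemma Phi_inf_scale B s xi : 0 < s <= 1 ->
  (Phi_inf mu Omega Phi B (s *: xi)%R <= s%:E * Phi_inf mu Omega Phi B xi)%E.
Proof.
case/andP=> s0 s1; rewrite muleC -lee_pdivrMr //; apply/le_ess_inf_onP.
have /le_ess_inf_onP := lexx (Phi_inf mu Omega Phi B (s *: xi)%R).
have := Phi_convex hPhi; have := Phi_limits hPhi.
apply: filterS3 => z z0 cz ls [Bz Oz].
rewrite lee_pdivrMr // muleC; apply: le_trans (ls (conj Bz Oz)) _.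
apply: convex_ereal_scale (cz Oz) _ _; last by rewrite (ltW s0).
by have [->] := z0 Oz.
Qed.

End PhiBounds.

Theorem theorem1p2 (R : realType) (n m : nat)
    (mu : {measure set (borel_rV R n) -> \bar R}) (Omega : set 'rV[R]_n)
    (Phi : 'rV[R]_n -> 'rV[R]_m -> \bar R)
    (hOmega : open Omega) (hPhi : strong_Phi_function mu Omega Phi) :
  condition_A1 mu Omega Phi <-> condition_M mu Omega Phi.
Proof.
split=> hyp K K0; last first.
  have [beta beta0 hbeta] := hyp K K0; exists beta => // c r r0 B BO B1 xi FK.
  have envF := convex_envelope_le (Phi_inf mu Omega Phi B) xi.
  apply: le_trans (hbeta c r r0 BO B1 xi (le_trans envF FK)) _.
  by rewrite leeD2r.
have K20 : 0 < K * 2 by rewrite mulr_gt0.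
have [beta beta0 hbeta] := hyp _ K20.
exists (beta * 2^-1); first by rewrite divr_gt0.
move=> c r r0 B BO B1 xi; set F := Phi_inf mu Omega Phi B => envK.
have F0 : forall x, (0 <= F x)%E by exact: Phi_inf_ge0 hPhi B.
have [->|env_oo] := eqVneq (convex_envelope F xi) +oo%E.
  by rewrite addye ?leey.
have fenv : convex_envelope F xi \is a fin_num.
  by rewrite ge0_fin_numE ?convex_envelope_ge0 // ltey.
(* Doubling K leaves room for a level L strictly above the envelope; when B is
   null, the bound on the right is infinite and any larger L is admissible. *)
have [L [L0 envL LK]] : exists L : R,
    [/\ 0 < L, (convex_envelope F xi < L%:E)%E & (L%:E <= (K * 2)%:E / mu B)%E].
  have fB : mu B \is a fin_num.
    by rewrite ge0_fin_numE // (le_lt_trans B1) ?ltry.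
  have : 0 <= fine (mu B) by rewrite fine_ge0.
  move: envK; rewrite -(fineK fB); set b := fine _.
  rewrite inver; case: eqVneq => [_ _ _|b0 envK b_ge0].
    exists (fine (convex_envelope F xi) + 1); split.
    - by rewrite ltr_wpDl // fine_ge0 // convex_envelope_ge0.
    - by rewrite EFinD fineK // lteDl // lte01.
    - by rewrite gt0_muley ?lte_fin ?leey.
  have b_gt0 : 0 < b by rewrite lt_neqAle eq_sym b0.
  exists (K * 2 / b); split; first by rewrite divr_gt0.
  - apply: le_lt_trans envK _.
    by rewrite -EFinM lte_fin ltr_pM2r ?invr_gt0 // ltr_pMr // ltr1n.
  - by rewrite EFinM.
pose Psi x := Phi_sup mu Omega Phi B (beta *: x).
rewrite -scalerA -/(Psi _).
apply: (half_le_convex_envelope (Psi := Psi) L0 F0 _ _ _ _ envL).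
- by move=> s x s01; exact: Phi_inf_scale hPhi _ _ _ s01.
- move=> x y t t01; rewrite /Psi scalerDr !scalerA ![beta * _]mulrC -!scalerA.
  exact: Phi_sup_convex hPhi _ _ _ _ t01.
- by rewrite /Psi scaler0; exact: Phi_sup0_le0 hPhi B.
- by move=> x FL; apply: hbeta (le_trans FL LK).
Qed.
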